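(* Let $M$ be a smooth manifold, $\nabla$ an affine connection on $M$, and $h$ a non-degenerate $(0,2)$-tensor field on $M$. Let $\hat\nabla$ and $\hat\nabla^*$ be the connections on $TM\oplus T^*M$ given by $$\hat\nabla_{X+\eta}(Y+\beta)=\nabla_XY+h(\nabla_X(h^{-1}(\beta))),\qquad \hat\nabla^*_{X+\eta}(Y+\beta)=h^{-1}(\nabla_X(h(Y)))+\nabla_X\beta,$$ and for $\alpha\in\mathbb{R}$ let $\hat\nabla^{(\alpha)}=\frac{1+\alpha}{2}\hat\nabla+\frac{1-\alpha}{2}\hat\nabla^*$. Then the curvature of $\hat\nabla^{(\alpha)}$ is $$R^{\hat\nabla^{(\alpha)}}(X+\eta,Y+\beta)(Z+\gamma)=\frac{1+\alpha}{2}R^{\nabla}(X,Y)Z+\frac{1-\alpha}{2}h^{-1}(R^{\nabla}(X,Y)(h(Z)))$$ $$+\frac{1-\alpha^2}{4}\{h^{-1}(\nabla_Y\nabla_X(h(Z)))-h^{-1}(\nabla_Y(h(\nabla_XZ)))-\nabla_Y(h^{-1}(\nabla_X(h(Z))))+\nabla_Y\nabla_XZ$$ $$-h^{-1}(\nabla_X\nabla_Y(h(Z)))+h^{-1}(\nabla_X(h(\nabla_YZ)))+\nabla_X(h^{-1}(\nabla_Y(h(Z))))-\nabla_X\nabla_YZ\}$$ $$+\frac{1+\alpha}{2}h(R^{\nabla}(X,Y)(h^{-1}(\gamma)))+\frac{1-\alpha}{2}R^{\nabla}(X,Y)\gamma$$ $$+\frac{1-\alpha^2}{4}\{\nabla_Y\nabla_X\gamma-\nabla_Y(h(\nabla_X(h^{-1}(\gamma))))-h(\nabla_Y(h^{-1}(\nabla_X\gamma)))+h(\nabla_Y\nabla_X(h^{-1}(\gamma)))$$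 $$-\nabla_X\nabla_Y\gamma+\nabla_X(h(\nabla_Y(h^{-1}(\gamma))))+h(\nabla_X(h^{-1}(\nabla_Y\gamma)))-h(\nabla_X\nabla_Y(h^{-1}(\gamma)))\},$$ for all vector fields $X,Y,Z$ and all $1$-forms $\eta,\beta,\gamma$ on $M$.
   Context: The tensor $h$ is identified with the bundle isomorphism $h:TM\to T^*M$, $h(X)=h(X,\cdot)$, with inverse $h^{-1}$. The connection $\nabla$ acts on $1$-forms by $(\nabla_X\beta)(Y)=X(\beta(Y))-\beta(\nabla_XY)$. $R^\nabla(X,Y)=\nabla_X\nabla_Y-\nabla_Y\nabla_X-\nabla_{[X,Y]}$, acting on vector fields and on $1$-forms. Sections of $TM\oplus T^*M$ are written $X+\eta$ and carry the bracket $[X+\eta,Y+\beta]_\nabla=[X,Y]+\nabla_X\beta-\nabla_Y\eta$. For a connection $D$ on $TM\oplus T^*M$ (differentiating along sections $\sigma$ of $TM\oplus T^*M$), $R^D(\sigma,\tau)\nu=D_\sigma D_\tau\nu-D_\tau D_\sigma\nu-D_{[\sigma,\tau]_\nabla}\nu$. *)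

(* Defs.v *)
From HB Require Import structures.
From mathcomp Require Import all_boot all_order all_algebra.
From mathcomp Require Import ring.
From mathcomp Require Import all_classical all_reals all_analysis.

Set Implicit Arguments.
Unset Strict Implicit.
Unset Printing Implicit Defensive.

Import Order.TTheory GRing.Theory Num.Theory.
Import numFieldNormedType.Exports.

Local Open Scope classical_set_scope.
Local Open Scope ring_scope.

Section SmoothOn.
Variables (R : realType) (n : nat).
Implicit Types (U : set 'rV[R]_n) (f g : 'rV[R]_n -> R).

Definition ebasis (i : 'I_n) : 'rV[R]_n := delta_mx ord0 i.

(* All iterated partial derivatives of order at most k exist and are
   continuous at the points of U.  It is only used for open U. *)
Fixpoint Ck_on (k : nat) U f : Prop :=
  (forall x, U x -> {for x, continuous f}) /\
  match k with
  | 0 => True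
  | k'.+1 => forall i : 'I_n,
      (forall x, U x -> derivable f x (ebasis i)) /\
      Ck_on k' U (fun x => 'D_(ebasis i) f x)
  end.

Definition smooth_on U f := forall k, Ck_on k U f.

Let near_eq_on U f g x : open U -> (forall y, U y -> f y = g y) -> U x ->
  \forall y \near x, f y = g y.
Proof. by move=> oU fg Ux; apply: filterS (open_nbhs_nbhs (conj oU Ux)). Qed.

Let near_continuous_at U f g x : open U -> (forall y, U y -> f y = g y) ->
  U x -> {for x, continuous f} -> {for x, continuous g}.
Proof.
move=> oU fg Ux cf; rewrite /prop_for /continuous_at -(fg x Ux).
by apply: cvg_trans cf; exact: (near_eq_cvg (near_eq_on oU fg Ux)).
Qed.

Lemma Ck_on_ext k U f g : open U -> (forall x, U x -> f x = g x) ->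
  Ck_on k U f -> Ck_on k U g.
Proof.
move=> oU; elim: k f g => [|k IH] f g fg.
  by case=> cf _; split=> // x Ux;
    exact: near_continuous_at oU fg Ux (cf x Ux).
case=> cf df; split=> [x Ux|i].
  exact: near_continuous_at oU fg Ux (cf x Ux).
have [dfi Cfi] := df i; have nfg x (Ux : U x) := near_eq_on oU fg Ux.
split=> [x Ux|]; first exact: near_eq_derivable (nfg x Ux) (dfi x Ux).
by apply: IH Cfi => x Ux; apply: near_eq_derive; exact: nfg.
Qed.

Lemma Ck_onW k U f : Ck_on k.+1 U f -> Ck_on k U f.
Proof.
elim: k f => [|k IH] f /= [cf df]; first by split.
by split=> // i; have [dfi Cfi] := df i; split=> //; apply: IH.
Qed.

Lemma Ck_on_cst k U (c : R) : Ck_on k U (cst c).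
Proof.
elim: k c => [|k IH] c /=; first by split=> // x _; exact: cst_continuous.
split=> [x _|i]; first exact: cst_continuous.
split=> [x _|]; first exact: derivable_cst.
have -> : (fun x => 'D_(ebasis i) (cst c) x) = cst 0.
  by apply/funext => x; rewrite derive_cst.
exact: IH.
Qed.

Lemma Ck_onD k U f g : open U ->
  Ck_on k U f -> Ck_on k U g -> Ck_on k U (f + g).
Proof.
move=> oU; elim: k f g => [|k IH] f g /= [cf df] [cg dg].
  by split=> // x Ux; apply: continuousD; [exact: cf|exact: cg].
split=> [x Ux|i]; first by apply: continuousD; [exact: cf|exact: cg].
have [dfi Cfi] := df i; have [dgi Cgi] := dg i; split=> [x Ux|].
  by apply: derivableD; [exact: dfi|exact: dgi].
apply: Ck_on_ext oU _ (IH _ _ Cfi Cgi) => x Ux.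
by rewrite deriveD; [|exact: dfi|exact: dgi].
Qed.

Lemma Ck_onM k U f g : open U ->
  Ck_on k U f -> Ck_on k U g -> Ck_on k U (f * g).
Proof.
move=> oU; elim: k f g => [|k IH] f g Cf Cg;
  move: (Cf) (Cg) => /= [cf df] [cg dg].
  by split=> // x Ux; apply: continuousM; [exact: cf|exact: cg].
split=> [x Ux|i]; first by apply: continuousM; [exact: cf|exact: cg].
have [dfi Cfi] := df i; have [dgi Cgi] := dg i; split=> [x Ux|].
  by apply: derivableM; [exact: dfi|exact: dgi].
have Cfg := IH _ _ (Ck_onW Cf) Cgi; have Cgf := IH _ _ (Ck_onW Cg) Cfi.
apply: Ck_on_ext oU _ (Ck_onD oU Cfg Cgf) => x Ux.
by rewrite deriveM; [|exact: dfi|exact: dgi].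
Qed.

End SmoothOn.

Section Manifold.
Variables (R : realType) (n : nat).

(* [chart_inv] is only meaningful on the image of [chart_dom]. *)
Record chart (M : topologicalType) := Chart {
  chart_dom : set M;
  chart_map :> M -> 'rV[R]_n;
  chart_inv : 'rV[R]_n -> M;
  chart_dom_open : open chart_dom;
  chart_im_open : open (chart_map @` chart_dom);
  chart_continuous : forall p, chart_dom p -> {for p, continuous chart_map};
  chart_inv_continuous : forall x, (chart_map @` chart_dom) x ->
    {for x, continuous chart_inv};
  chartK : forall p, chart_dom p -> chart_inv (chart_map p) = p }.

Definition chart_im (M : topologicalType) (c : chart M) : set 'rV[R]_n :=
  c @` chart_dom c.

Definition smooth_transition (M : topologicalType) (c d : chart M) :=
  forall i : 'I_n, smooth_on (c @` (chart_dom c `&` chart_dom d))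
    (fun x => d (chart_inv c x) ord0 i).

(* The atlas is not required to be maximal: a smooth atlas determines a unique
   maximal one, with the same smooth functions. *)
Record manifold := Manifold {
  carrier :> topologicalType;
  atlas : set (chart carrier);
  carrier_hausdorff : hausdorff_space carrier;
  carrier_second_countable : @second_countable carrier;
  atlas_cover : forall p : carrier, exists2 c, atlas c & chart_dom c p;
  atlas_smooth : forall c d, atlas c -> atlas d -> smooth_transition c d }.

End Manifold.

Section SmoothFunctions.
Variables (R : realType) (n : nat) (M : manifold R n).

Definition smooth (f : M -> R) : Prop :=
  forall c, atlas c -> smooth_on (chart_im c) (f \o chart_inv c).

Record smoothfun := SmoothFun { sfun_val :> M -> R; sfunP : smooth sfun_val }.

HB.instance Definition _ := gen_eqMixin smoothfun.
HB.instance Definition _ := gen_choiceMixin smoothfun.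

Lemma sfun_ext (f g : smoothfun) : (forall p, f p = g p) -> f = g.
Proof.
case: f g => [f fS] [g gS] /= /funext fg; case: _ / fg gS => gS.
by congr SmoothFun; exact: Prop_irrelevance.
Qed.

Lemma smooth_cst (c : R) : smooth (fun=> c).
Proof. by move=> d _ k; exact: Ck_on_cst. Qed.

Lemma smoothD (f g : smoothfun) : smooth (fun p => f p + g p).
Proof.
move=> c Ac k; have oc : open (chart_im c) := @chart_im_open _ _ _ c.
by apply: Ck_on_ext oc _ (Ck_onD oc (sfunP f Ac k) (sfunP g Ac k)).
Qed.

Lemma smoothM (f g : smoothfun) : smooth (fun p => f p * g p).
Proof.
move=> c Ac k; have oc : open (chart_im c) := @chart_im_open _ _ _ c.
by apply: Ck_on_ext oc _ (Ck_onM oc (sfunP f Ac k) (sfunP g Ac k)).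
Qed.

Definition sfun_cst c := SmoothFun (smooth_cst c).
Definition sfun_add f g := SmoothFun (smoothD f g).
Definition sfun_mul f g := SmoothFun (smoothM f g).
Definition sfun_opp f := sfun_mul (sfun_cst (-1)) f.

Fact sfun_addA : associative sfun_add.
Proof. by move=> f g h; apply: sfun_ext => p /=; rewrite addrA. Qed.
Fact sfun_addC : commutative sfun_add.
Proof. by move=> f g; apply: sfun_ext => p /=; rewrite addrC. Qed.
Fact sfun_add0 : left_id (sfun_cst 0) sfun_add.
Proof. by move=> f; apply: sfun_ext => p /=; rewrite add0r. Qed.
Fact sfun_addN : left_inverse (sfun_cst 0) sfun_opp sfun_add.
Proof. by move=> f; apply: sfun_ext => p /=; rewrite mulN1r addNr. Qed.

HB.instance Definition _ :=
  GRing.isZmodule.Build smoothfun sfun_addA sfun_addC sfun_add0 sfun_addN.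

Fact sfun_mulA : associative sfun_mul.
Proof. by move=> f g h; apply: sfun_ext => p /=; rewrite mulrA. Qed.
Fact sfun_mulC : commutative sfun_mul.
Proof. by move=> f g; apply: sfun_ext => p /=; rewrite mulrC. Qed.
Fact sfun_mul1 : left_id (sfun_cst 1) sfun_mul.
Proof. by move=> f; apply: sfun_ext => p /=; rewrite mul1r. Qed.
Fact sfun_mulDl : left_distributive sfun_mul +%R.
Proof. by move=> f g h; apply: sfun_ext => p /=; rewrite mulrDl. Qed.

HB.instance Definition _ :=
  GRing.Zmodule_isComPzRing.Build smoothfun
    sfun_mulA sfun_mulC sfun_mul1 sfun_mulDl.

Definition sfun_scale (a : R) f := sfun_mul (sfun_cst a) f.

Fact sfun_scaleA a b f : sfun_scale a (sfun_scale b f) = sfun_scale (a * b) f.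
Proof. by apply: sfun_ext => p /=; rewrite mulrA. Qed.
Fact sfun_scale1 : left_id 1 sfun_scale.
Proof. by move=> f; apply: sfun_ext => p /=; rewrite mul1r. Qed.
Fact sfun_scaleDr : right_distributive sfun_scale +%R.
Proof. by move=> a f g; apply: sfun_ext => p /=; rewrite mulrDr. Qed.
Fact sfun_scaleDl f : {morph sfun_scale^~ f : a b / a + b}.
Proof. by move=> a b; apply: sfun_ext => p /=; rewrite mulrDl. Qed.

HB.instance Definition _ :=
  GRing.Zmodule_isLmodule.Build R smoothfun
    sfun_scaleA sfun_scale1 sfun_scaleDr sfun_scaleDl.

Lemma sfunDE (f g : smoothfun) p : (f + g) p = f p + g p.
Proof. by []. Qed.
Lemma sfunME (f g : smoothfun) p : (f * g) p = f p * g p.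
Proof. by []. Qed.
Lemma sfunNE (f : smoothfun) p : (- f) p = - f p.
Proof. exact: mulN1r. Qed.
Lemma sfunZE a (f : smoothfun) p : (a *: f) p = a * f p.
Proof. by []. Qed.

Lemma sfunZAl a (f g : smoothfun) : a *: (f * g) = (a *: f) * g.
Proof. exact: sfun_mulA. Qed.
Lemma sfunZAr a (f g : smoothfun) : a *: (f * g) = f * (a *: g).
Proof. by rewrite mulrC sfunZAl mulrC. Qed.

End SmoothFunctions.

Section VectorFields.
Variables (R : realType) (n : nat) (M : manifold R n).

(* Smooth vector fields, as the derivations of the algebra of smooth
   functions; [X f p] is the tangent vector X_p applied to f. *)
Record vfield := VField {
  vfield_fun :> smoothfun M -> smoothfun M;
  vfield_linear : forall (a : R) (f g : smoothfun M),
    vfield_fun (a *: f + g) = a *: vfield_fun f + vfield_fun g;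
  vfield_leibniz : forall f g : smoothfun M,
    vfield_fun (f * g) = f * vfield_fun g + g * vfield_fun f }.

HB.instance Definition _ := gen_eqMixin vfield.
HB.instance Definition _ := gen_choiceMixin vfield.

Lemma vfield_ext (X Y : vfield) : (forall f, X f = Y f) -> X = Y.
Proof.
case: X Y => [X X1 X2] [Y Y1 Y2] /= /funext XY; case: _ / XY Y1 Y2 => Y1 Y2.
by congr VField; exact: Prop_irrelevance.
Qed.

Lemma vfieldD (X : vfield) f g : X (f + g) = X f + X g.
Proof. by have := vfield_linear X 1 f g; rewrite !scale1r. Qed.
Lemma vfield0 (X : vfield) : X 0 = 0.
Proof. by apply: (addrI (X 0)); rewrite -vfieldD !addr0. Qed.
Lemma vfieldZ (X : vfield) (a : R) f : X (a *: f) = a *: X f.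
Proof. by have := vfield_linear X a f 0; rewrite vfield0 !addr0. Qed.
Lemma vfieldN (X : vfield) f : X (- f) = - X f.
Proof. by apply: (addrI (X f)); rewrite -vfieldD !subrr vfield0. Qed.
Lemma vfieldB (X : vfield) f g : X (f - g) = X f - X g.
Proof. by rewrite vfieldD vfieldN. Qed.

Definition vfield_zero : vfield.
Proof.
exists (fun=> 0) => [a f g|f g]; first by rewrite scaler0 addr0.
by rewrite !mulr0 addr0.
Defined.

Definition vfield_add (X Y : vfield) : vfield.
Proof.
exists (fun f => X f + Y f) => [a f g|f g].
  by rewrite !vfield_linear scalerDr addrACA.
by rewrite !vfield_leibniz !mulrDr addrACA.
Defined.

Definition vfield_opp (X : vfield) : vfield.
Proof.
exists (fun f => - X f) => [a f g|f g].
  by rewrite vfield_linear opprD scalerN.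
by rewrite vfield_leibniz opprD !mulrN.
Defined.

Definition vfield_scale (u : smoothfun M) (X : vfield) : vfield.
Proof.
exists (fun f => u * X f) => [a f g|f g].
  by rewrite vfield_linear mulrDr sfunZAr.
by rewrite vfield_leibniz mulrDr !mulrA (mulrC u f) (mulrC u g).
Defined.

Fact vfield_addA : associative vfield_add.
Proof. by move=> X Y Z; apply: vfield_ext => f /=; rewrite addrA. Qed.
Fact vfield_addC : commutative vfield_add.
Proof. by move=> X Y; apply: vfield_ext => f /=; rewrite addrC. Qed.
Fact vfield_add0 : left_id vfield_zero vfield_add.
Proof. by move=> X; apply: vfield_ext => f /=; rewrite add0r. Qed.
Fact vfield_addN : left_inverse vfield_zero vfield_opp vfield_add.
Proof. by move=> X; apply: vfield_ext => f /=; rewrite addNr. Qed.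

HB.instance Definition _ :=
  GRing.isZmodule.Build vfield vfield_addA vfield_addC vfield_add0 vfield_addN.

Fact vfield_scaleA u v X :
  vfield_scale u (vfield_scale v X) = vfield_scale (u * v) X.
Proof. by apply: vfield_ext => f /=; rewrite mulrA. Qed.
Fact vfield_scale1 : left_id 1 vfield_scale.
Proof. by move=> X; apply: vfield_ext => f /=; rewrite mul1r. Qed.
Fact vfield_scaleDr : right_distributive vfield_scale +%R.
Proof. by move=> u X Y; apply: vfield_ext => f /=; rewrite mulrDr. Qed.
Fact vfield_scaleDl X : {morph vfield_scale^~ X : u v / u + v}.
Proof. by move=> u v; apply: vfield_ext => f /=; rewrite mulrDl. Qed.

HB.instance Definition _ :=
  GRing.Zmodule_isLmodule.Build (smoothfun M) vfield
    vfield_scaleA vfield_scale1 vfield_scaleDr vfield_scaleDl.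

Lemma vfieldDE (X Y : vfield) f : (X + Y) f = X f + Y f.
Proof. by []. Qed.
Lemma vfieldNE (X : vfield) f : (- X) f = - X f.
Proof. by []. Qed.
Lemma vfieldZE u (X : vfield) f : (u *: X) f = u * X f.
Proof. by []. Qed.

Definition lie (X Y : vfield) : vfield.
Proof.
exists (fun f => X (Y f) - Y (X f)) => [a f g|f g].
  rewrite !vfield_linear scalerDr scalerN opprD.
  by rewrite addrACA.
rewrite !vfield_leibniz !vfieldD !vfield_leibniz !mulrBr !opprD.
apply: sfun_ext => p; rewrite !(sfunDE, sfunNE, sfunME).
ring.
Defined.

End VectorFields.

Section OneForms.
Variables (R : realType) (n : nat) (M : manifold R n).

(* Smooth 1-forms and (0,2)-tensor fields are identified, as usual, with the
   multilinear maps they induce on vector fields over the smooth functions. *)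
Record oneform := OneForm {
  oneform_fun :> vfield M -> smoothfun M;
  oneform_linear : scalar oneform_fun }.

HB.instance Definition _ := gen_eqMixin oneform.
HB.instance Definition _ := gen_choiceMixin oneform.

Lemma oneform_ext (b c : oneform) : (forall X, b X = c X) -> b = c.
Proof.
case: b c => [b b1] [c c1] /= /funext bc; case: _ / bc c1 => c1.
by congr OneForm; exact: Prop_irrelevance.
Qed.

Lemma oneformD (b : oneform) X Y : b (X + Y) = b X + b Y.
Proof. by have := oneform_linear b 1 X Y; rewrite scale1r mul1r. Qed.
Lemma oneform0 (b : oneform) : b 0 = 0.
Proof. by apply: (addrI (b 0)); rewrite -oneformD !addr0. Qed.
Lemma oneformZ (b : oneform) u X : b (u *: X) = u * b X.
Proof. by have := oneform_linear b u X 0; rewrite oneform0 !addr0. Qed.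
Lemma oneformN (b : oneform) X : b (- X) = - b X.
Proof. by apply: (addrI (b X)); rewrite -oneformD !subrr oneform0. Qed.
Lemma oneformB (b : oneform) X Y : b (X - Y) = b X - b Y.
Proof. by rewrite oneformD oneformN. Qed.

Definition oneform_zero : oneform.
Proof. by exists (fun=> 0) => u X Y; rewrite mulr0 addr0. Defined.

Definition oneform_add (b c : oneform) : oneform.
Proof.
by exists (fun X => b X + c X) => u X Y; rewrite !oneform_linear mulrDr addrACA.
Defined.

Definition oneform_opp (b : oneform) : oneform.
Proof.
by exists (fun X => - b X) => u X Y; rewrite oneform_linear opprD mulrN.
Defined.

Definition oneform_scale (v : smoothfun M) (b : oneform) : oneform.
Proof.
exists (fun X => v * b X) => u X Y.
by rewrite oneform_linear mulrDr !mulrA (mulrC v).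
Defined.

Fact oneform_addA : associative oneform_add.
Proof. by move=> a b c; apply: oneform_ext => X /=; rewrite addrA. Qed.
Fact oneform_addC : commutative oneform_add.
Proof. by move=> a b; apply: oneform_ext => X /=; rewrite addrC. Qed.
Fact oneform_add0 : left_id oneform_zero oneform_add.
Proof. by move=> a; apply: oneform_ext => X /=; rewrite add0r. Qed.
Fact oneform_addN : left_inverse oneform_zero oneform_opp oneform_add.
Proof. by move=> a; apply: oneform_ext => X /=; rewrite addNr. Qed.

HB.instance Definition _ :=
  GRing.isZmodule.Build oneform
    oneform_addA oneform_addC oneform_add0 oneform_addN.

Fact oneform_scaleA u v b :
  oneform_scale u (oneform_scale v b) = oneform_scale (u * v) b.
Proof. by apply: oneform_ext => X /=; rewrite mulrA. Qed.
Fact oneform_scale1 : left_id 1 oneform_scale.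
Proof. by move=> b; apply: oneform_ext => X /=; rewrite mul1r. Qed.
Fact oneform_scaleDr : right_distributive oneform_scale +%R.
Proof. by move=> u b c; apply: oneform_ext => X /=; rewrite mulrDr. Qed.
Fact oneform_scaleDl b : {morph oneform_scale^~ b : u v / u + v}.
Proof. by move=> u v; apply: oneform_ext => X /=; rewrite mulrDl. Qed.

HB.instance Definition _ :=
  GRing.Zmodule_isLmodule.Build (smoothfun M) oneform
    oneform_scaleA oneform_scale1 oneform_scaleDr oneform_scaleDl.

Lemma oneformDE (b c : oneform) X : (b + c) X = b X + c X.
Proof. by []. Qed.
Lemma oneformNE (b : oneform) X : (- b) X = - b X.
Proof. by []. Qed.
Lemma oneformZE u (b : oneform) X : (u *: b) X = u * b X.
Proof. by []. Qed.

Record tensor02 := Tensor02 {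
  tensor_fun :> vfield M -> vfield M -> smoothfun M;
  tensor_linearl : forall Y, scalar (tensor_fun ^~ Y);
  tensor_linearr : forall X, scalar (tensor_fun X) }.

(* h_p(u, .) = 0 implies u = 0, at every point p; every tangent vector at p is
   the value at p of a vector field, which vanishes at p iff X f p = 0 for
   every f. *)
Definition tensor_nondegenerate (h : tensor02) : Prop :=
  forall (p : M) (X : vfield M),
    (forall Y : vfield M, h X Y p = 0) -> forall f : smoothfun M, X f p = 0.

Definition flat (h : tensor02) (X : vfield M) : oneform :=
  OneForm (tensor_linearr h X).

End OneForms.

Section Connections.
Variables (R : realType) (n : nat) (M : manifold R n).

Record affine_connection := AffineConnection {
  nabla_fun :> vfield M -> vfield M -> vfield M;
  nabla_linearl : forall Y, linear (nabla_fun ^~ Y);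
  nabla_additive : forall X Y Z,
    nabla_fun X (Y + Z) = nabla_fun X Y + nabla_fun X Z;
  nabla_leibniz : forall X (f : smoothfun M) Y,
    nabla_fun X (f *: Y) = X f *: Y + f *: nabla_fun X Y }.

Definition nabla_form (nabla : affine_connection) (X : vfield M)
    (b : oneform M) : oneform M.
Proof.
exists (fun Y => X (b Y) - b (nabla X Y)) => u Y Z.
rewrite oneform_linear nabla_additive nabla_leibniz !oneformD !oneformZ vfieldD.
rewrite vfield_leibniz; apply: sfun_ext => p.
by rewrite !(sfunDE, sfunNE, sfunME); ring.
Defined.

Lemma nabla_formE (nabla : affine_connection) (X Y : vfield M) (b : oneform M) :
  nabla_form nabla X b Y = X (b Y) - b (nabla X Y).
Proof. by []. Qed.

Definition curvature (S V : zmodType) (bracket : S -> S -> S) (D : S -> V -> V)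
    (s t : S) (v : V) : V :=
  D s (D t v) - D t (D s v) - D (bracket s t) v.

Definition curvature_vect (nabla : affine_connection) :
  vfield M -> vfield M -> vfield M -> vfield M := curvature (@lie _ _ M) nabla.

Definition curvature_form (nabla : affine_connection) :
  vfield M -> vfield M -> oneform M -> oneform M :=
  curvature (@lie _ _ M) (nabla_form nabla).

(* The section X + eta of TM (+) T*M is the pair (X, eta). *)
Definition gsection : lmodType (smoothfun M) := (vfield M * oneform M)%type.

Definition gbracket (nabla : affine_connection) (s t : gsection) : gsection :=
  (lie s.1 t.1, nabla_form nabla s.1 t.2 - nabla_form nabla t.1 s.2).

Definition rscale (V : lmodType (smoothfun M)) (a : R) (v : V) : V :=
  sfun_cst M a *: v.

Definition is_gconnection (D : gsection -> gsection -> gsection) : Prop :=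
  [/\ forall v, linear (D ^~ v),
      forall s v w, D s (v + w) = D s v + D s w
    & forall s (f : smoothfun M) v, D s (f *: v) = s.1 f *: v + f *: D s v].

Definition hat (nabla : affine_connection) (h : tensor02 M)
    (hinv : oneform M -> vfield M) (s v : gsection) : gsection :=
  (nabla s.1 v.1, flat h (nabla s.1 (hinv v.2))).

Definition hat_star (nabla : affine_connection) (h : tensor02 M)
    (hinv : oneform M -> vfield M) (s v : gsection) : gsection :=
  (hinv (nabla_form nabla s.1 (flat h v.1)), nabla_form nabla s.1 v.2).

Definition hat_alpha (nabla : affine_connection) (h : tensor02 M)
    (hinv : oneform M -> vfield M) (alpha : R) (s v : gsection) : gsection :=
  rscale ((1 + alpha) / 2) (hat nabla h hinv s v) +
  rscale ((1 - alpha) / 2) (hat_star nabla h hinv s v).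

Definition curvature_gen (nabla : affine_connection)
    (D : gsection -> gsection -> gsection) :
  gsection -> gsection -> gsection -> gsection := curvature (gbracket nabla) D.

Lemma nabla_form_linearl (nabla : affine_connection) (b : oneform M) :
  linear (nabla_form nabla ^~ b).
Proof.
move=> u X Y; apply: oneform_ext => Z.
rewrite oneformDE oneformZE !nabla_formE nabla_linearl oneformD oneformZ.
rewrite vfieldDE vfieldZE; apply: sfun_ext => p.
by rewrite !(sfunDE, sfunNE, sfunME); ring.
Qed.

Lemma nabla_form_additive (nabla : affine_connection) X (b c : oneform M) :
  nabla_form nabla X (b + c) = nabla_form nabla X b + nabla_form nabla X c.
Proof.
apply: oneform_ext => Z.
by rewrite oneformDE !nabla_formE !oneformDE vfieldD opprD addrACA.
Qed.

Lemma nabla_form_leibniz (nabla : affine_connection) X f (b : oneform M) :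
  nabla_form nabla X (f *: b) = X f *: b + f *: nabla_form nabla X b.
Proof.
apply: oneform_ext => Z.
rewrite oneformDE !oneformZE !nabla_formE !oneformZE vfield_leibniz.
by apply: sfun_ext => p; rewrite !(sfunDE, sfunNE, sfunME); ring.
Qed.

Lemma flat_linear (h : tensor02 M) : linear (flat h).
Proof. by move=> u X Y; apply: oneform_ext => Z /=; rewrite tensor_linearl. Qed.

Lemma inv_flat_linear (h : tensor02 M) (hinv : oneform M -> vfield M) :
  cancel (flat h) hinv -> cancel hinv (flat h) -> linear hinv.
Proof.
move=> hK hinvK u b c; apply: (can_inj hK).
by rewrite flat_linear !hinvK.
Qed.

Section GConnections.
Variables (nabla : affine_connection) (h : tensor02 M).
Variable hinv : oneform M -> vfield M.
Hypotheses (hK : cancel (flat h) hinv) (hinvK : cancel hinv (flat h)).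

Let semilin (U V : lmodType (smoothfun M)) (f : U -> V) : linear f ->
  (forall x y, f (x + y) = f x + f y) /\ (forall a x, f (a *: x) = a *: f x).
Proof.
move=> fL; have fD x y : f (x + y) = f x + f y.
  by have := fL 1 x y; rewrite !scale1r.
have f0 : f 0 = 0 by apply: (addrI (f 0)); rewrite -fD !addr0.
by split=> // a x; have := fL a x 0; rewrite f0 !addr0.
Qed.

Lemma hat_gconnection : is_gconnection (hat nabla h hinv).
Proof.
have [fD fZ] := semilin (flat_linear h).
have [iD iZ] := semilin (inv_flat_linear hK hinvK).
split=> [v u s t|s v w|s f v].
- by congr pair; rewrite /= nabla_linearl ?flat_linear.
- by congr pair; rewrite /= ?iD nabla_additive ?fD.
- by congr pair; rewrite /= ?iZ nabla_leibniz ?fD ?fZ ?hinvK.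
Qed.

Lemma hat_star_gconnection : is_gconnection (hat_star nabla h hinv).
Proof.
have [fD fZ] := semilin (flat_linear h).
have [iD iZ] := semilin (inv_flat_linear hK hinvK).
split=> [v u s t|s v w|s f v].
- by congr pair; rewrite /= nabla_form_linearl ?iD ?iZ.
- by congr pair; rewrite /= ?fD nabla_form_additive ?iD.
- by congr pair; rewrite /= ?fZ nabla_form_leibniz ?iD ?iZ ?hK.
Qed.

Lemma hat_alpha_gconnection alpha :
  is_gconnection (hat_alpha nabla h hinv alpha).
Proof.
have [L1 A1 Z1] := hat_gconnection; have [L2 A2 Z2] := hat_star_gconnection.
have scaleC c u (v : gsection) : c *: (u *: v) = u *: (c *: v).
  by rewrite !scalerA mulrC.
split=> [v u s t|s v w|s f v]; rewrite /hat_alpha /rscale.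
- by rewrite L1 L2 !scalerDr !(scaleC _ u) addrACA.
- by rewrite A1 A2 !scalerDr addrACA.
- rewrite Z1 Z2 !scalerDr !(scaleC _ f) addrACA.
  congr (_ + _); rewrite !scalerA -scalerDl; congr (_ *: v).
  by apply: sfun_ext => p; rewrite sfunDE !sfunME /=; field.
Qed.

End GConnections.

End Connections.

Notation "a *r: v" := (rscale a v) (at level 40) : ring_scope.

(* Main.v *)
(* Put a = (1 + alpha)/2 and b = (1 - alpha)/2, so that a + b = 1 and
   ab = (1 - alpha^2)/4.  In the curvature of a A + b B, with A = hat and
   B = hat_star, the quadratic terms AA, AB, BA, BB have coefficients
   a^2, ab, ab, b^2; substituting a^2 = a - ab and b^2 = b - ab gives
   a R^A + b R^B - ab [A_X - B_X, A_Y - B_Y].  Since A and B are nabla on one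
   summand and nabla conjugated by h on the other, R^A and R^B are R^nabla with
   the same conjugation. *)
Require Import Defs.
From mathcomp Require Import all_boot all_order all_algebra.
From mathcomp Require Import ring.
From mathcomp Require Import all_classical all_reals all_analysis.

Set Implicit Arguments.
Unset Strict Implicit.
Unset Printing Implicit Defensive.

Import Order.TTheory GRing.Theory Num.Theory.
Local Open Scope ring_scope.

(** The Leibniz rule on [1 * 1] gives [X 1 = X 1 + X 1], so [X 1] vanishes, and a constant is a real
    multiple of [1]. *)
Lemma vfield_cst (R : realType) (n : nat) (M : manifold R n)
    (X : vfield M) (c : R) : X (sfun_cst M c) = 0.
Proof.
have X1 : X 1 = 0.
  by have := vfield_leibniz X 1 1; rewrite !mul1r -{1}[X 1]addr0 => /addrI.
have -> : sfun_cst M c = c *: (1 : smoothfun M).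
  by apply: sfun_ext => p; rewrite sfunZE /= mulr1.
by rewrite vfieldZ X1 scaler0.
Qed.

(** The derivative term of the Leibniz rule vanishes on a constant; this lets the two weights be
    moved through the connections. *)
Lemma gconnection_rscale (R : realType) (n : nat) (M : manifold R n)
    (D : gsection M -> gsection M -> gsection M) (c : R) (s v : gsection M) :
  is_gconnection D -> D s (c *r: v) = c *r: D s v.
Proof. by case=> _ _ DZ; rewrite /rscale DZ vfield_cst scale0r add0r. Qed.

Lemma linear_subE (K : pzRingType) (U V : lmodType K) (f : U -> V) :
  linear f -> forall x y, f (x - y) = f x - f y.
Proof.
move=> fL x y; have := fL (-1) y x.
by rewrite !scaleN1r !(addrC (- _)).
Qed.

(** The bracket can stay abstract: its terms already carry the coefficients [a] and [b], so only the
    second-order terms have to be regrouped. *)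
Lemma curvature_affine_combination (K : comPzRingType) (S : zmodType)
    (V : lmodType K) (bracket : S -> S -> S) (A B : S -> V -> V) (a b : K) :
  a + b = 1 ->
  (forall s v w, A s (v + w) = A s v + A s w) ->
  (forall s v w, B s (v + w) = B s v + B s w) ->
  (forall s v, A s (a *: v) = a *: A s v) ->
  (forall s v, A s (b *: v) = b *: A s v) ->
  (forall s v, B s (a *: v) = a *: B s v) ->
  (forall s v, B s (b *: v) = b *: B s v) ->
  forall s t v,
    curvature bracket (fun s v => a *: A s v + b *: B s v) s t v =
    a *: curvature bracket A s t v + b *: curvature bracket B s t v +
    (a * b) *: (B t (B s v) - B t (A s v) - A t (B s v) + A t (A s v)
                - B s (B t v) + B s (A t v) + A s (B t v) - A s (A t v)).
Proof.
move=> ab1 AD BD Aa Ab Ba Bb s t v; rewrite /curvature.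
have aZ (x : V) : a *: x = (a * a) *: x + (a * b) *: x.
  by rewrite -scalerDl -mulrDr ab1 mulr1.
have bZ (x : V) : b *: x = (b * b) *: x + (a * b) *: x.
  by rewrite -scalerDl -mulrDl addrC ab1 mul1r.
rewrite !(AD, BD, Aa, Ab, Ba, Bb) ![in LHS]scalerDr ![in LHS]scalerA.
rewrite (mulrC b a).
(* Here [x], [y], [z], [w] stand for the AA, AB, BA, BB terms; [aZ] and [bZ] trade the squares for
   multiples of [a * b]. *)
have mix (x y z w : V) :
    (a * a) *: x + (a * b) *: y + ((a * b) *: z + (b * b) *: w) =
    a *: x + b *: w + (a * b) *: (y + z - (x + w)).
  rewrite (aZ x) (bZ w) scalerBr !scalerDr.
  rewrite [X in _ = X + _]addrACA addrC [RHS]addrC.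
  rewrite addrA subrK [RHS]addrC.
  by rewrite [RHS]addrACA [X in _ = _ + X]addrC.
set p := A (bracket s t) v; set q := B (bracket s t) v.
rewrite !mix.
set x := A s (A t v); set y := A s (B t v).
set z := B s (A t v); set w := B s (B t v).
set x' := A t (A s v); set y' := A t (B s v).
set z' := B t (A s v); set w' := B t (B s v).
(* [mix] was applied once per order of differentiation, primes marking [t] before [s]; the braces
   are the difference of the two remainders. *)
have -> : w' - z' - y' + x' - w + z + y - x =
    y + z - (x + w) - (y' + z' - (x' + w')).
  rewrite !opprB !opprD ![in RHS]addrA.
  by rewrite [LHS](ACl (7*6*8*5*4*1*3*2)).
move: (y + z - _) (y' + z' - _) => T T'.
rewrite !scalerBr !opprD.
by rewrite [LHS](AC (3*3*2) ((1*4*7)*(2*5*8)*(3*6))).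
Qed.

(** On the cotangent summand, the inner [hinv] and [flat h] of two successive derivatives cancel by
    [hK], and the bracket acts only through its vector part [lie X Y]. *)
Lemma curvature_hat (R : realType) (n : nat) (M : manifold R n)
    (nabla : affine_connection M) (h : tensor02 M)
    (hinv : oneform M -> vfield M) :
  cancel (flat h) hinv -> forall X Y Z eta beta gamma,
  curvature_gen nabla (hat nabla h hinv) (X, eta) (Y, beta) (Z, gamma) =
  (curvature_vect nabla X Y Z,
   flat h (curvature_vect nabla X Y (hinv gamma))).
Proof.
move=> hK X Y Z eta beta gamma; have flatB := linear_subE (flat_linear h).
rewrite /curvature_gen /curvature_vect /curvature /hat /gbracket /= !hK.
by rewrite !flatB.
Qed.

(** The conjugation now sits on the tangent summand and runs the other way, so the inner pair
    cancels by [hinvK]. *)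
Lemma curvature_hat_star (R : realType) (n : nat) (M : manifold R n)
    (nabla : affine_connection M) (h : tensor02 M)
    (hinv : oneform M -> vfield M) :
  cancel (flat h) hinv -> cancel hinv (flat h) ->
  forall X Y Z eta beta gamma,
  curvature_gen nabla (hat_star nabla h hinv) (X, eta) (Y, beta) (Z, gamma) =
  (hinv (curvature_form nabla X Y (flat h Z)), curvature_form nabla X Y gamma).
Proof.
move=> hK hinvK X Y Z eta beta gamma.
have invB := linear_subE (inv_flat_linear hK hinvK).
rewrite /curvature_gen /curvature_form /curvature /hat_star /gbracket /= !hinvK.
by rewrite !invB.
Qed.

Theorem proposition3p11 (R : realType) (n : nat) (M : manifold R n)
    (nabla : affine_connection M) (h : tensor02 M)
    (hinv : oneform M -> vfield M) (h_nondeg : tensor_nondegenerate h)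
    (hK : cancel (flat h) hinv) (hinvK : cancel hinv (flat h))
    (alpha : R) (X Y Z : vfield M) (eta beta gamma : oneform M) :
  let H := flat h in
  let D := nabla_form nabla in
  curvature_gen nabla (hat_alpha nabla h hinv alpha)
    (X, eta) (Y, beta) (Z, gamma) =
  ( ((1 + alpha) / 2) *r: curvature_vect nabla X Y Z +
    ((1 - alpha) / 2) *r: hinv (curvature_form nabla X Y (H Z)) +
    ((1 - alpha ^+ 2) / 4) *r:
      (hinv (D Y (D X (H Z))) - hinv (D Y (H (nabla X Z)))
       - nabla Y (hinv (D X (H Z))) + nabla Y (nabla X Z)
       - hinv (D X (D Y (H Z))) + hinv (D X (H (nabla Y Z)))
       + nabla X (hinv (D Y (H Z))) - nabla X (nabla Y Z))
  , ((1 + alpha) / 2) *r: H (curvature_vect nabla X Y (hinv gamma)) +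
    ((1 - alpha) / 2) *r: curvature_form nabla X Y gamma +
    ((1 - alpha ^+ 2) / 4) *r:
      (D Y (D X gamma) - D Y (H (nabla X (hinv gamma)))
       - H (nabla Y (hinv (D X gamma))) + H (nabla Y (nabla X (hinv gamma)))
       - D X (D Y gamma) + D X (H (nabla Y (hinv gamma)))
       + H (nabla X (hinv (D Y gamma))) - H (nabla X (nabla Y (hinv gamma))))).
Proof.
move=> H D; rewrite /curvature_gen.
have [_ hatD _] := hat_gconnection nabla hK hinvK.
have [_ starD _] := hat_star_gconnection nabla hK hinvK.
have hatZ c s v :=
  gconnection_rscale c s v (hat_gconnection nabla hK hinvK).
have starZ c s v :=
  gconnection_rscale c s v (hat_star_gconnection nabla hK hinvK).
(* The weights are constant functions, so both identities are checked pointwise in the reals. *)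
have cst1 : sfun_cst M ((1 + alpha) / 2) + sfun_cst M ((1 - alpha) / 2) = 1.
  by apply: sfun_ext => p; rewrite sfunDE /=; field.
have cstM : sfun_cst M ((1 + alpha) / 2) * sfun_cst M ((1 - alpha) / 2) =
    sfun_cst M ((1 - alpha ^+ 2) / 4).
  by apply: sfun_ext => p; rewrite sfunME /=; field.
etransitivity.
  exact: (curvature_affine_combination (gbracket nabla) cst1 hatD starD
    (hatZ _) (hatZ _) (starZ _) (starZ _)).
rewrite cstM.
rewrite [X in _ *: X + _ + _](curvature_hat _ hK).
rewrite [X in _ + _ *: X + _](curvature_hat_star _ hK hinvK).
(* In the mixed part, adjacent [hinv] and [flat h] remain only in the BB terms on vectors and the AA
   terms on forms. *)
by rewrite /hat /hat_star /= !hK !hinvK.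
Qed.
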